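(* (a) Let $m,n\ge3$. A non-overlapping $(m,n)$-framework $(p_1,\dots,p_m;\,q_1,\dots,q_n)$ in the Euclidean plane is a Dixon mechanism of the first kind if and only if, for each cycle $p_iq_jp_kq_l$ ($i\ne k$, $j\ne l$), the sums of squared lengths of the opposite sides are equal, i.e. $|p_iq_j|^2+|p_kq_l|^2=|q_jp_k|^2+|q_lp_i|^2$. The number of these conditions is $\binom m2\binom n2$, but only $(m-1)(n-1)$ of them are independent (as linear conditions on the squared rod lengths); one can choose, for example, only the conditions corresponding to the cycles $p_iq_jp_kq_l$ with fixed $i$ and $j$. (b) A flexible non-overlapping $(3,3)$-framework $(p_0,p_1,p_2;\,q_0,q_1,q_2)$ in the Euclidean plane is a Dixon mechanism of the second kind if and only if, up to renumbering of the vertices in the parts, there are $a,b,c,d$ such that $$|q_0p_0|=|q_1p_1|=|q_2p_2|=a,\quad |q_0p_1|=|q_1p_0|=b,\quad |q_0p_2|=|q_2p_0|=c,\quad |q_1p_2|=|q_2p_1|=d,$$ and the relation $a^2+c^2=b^2+d^2$ holds. In this case, all the 4-cycles twice including $a$ (that is, the cycles $p_iq_ip_jq_j$, $i<j$) are parallelogrammatic, i.e. have opposite sides of equal lengths.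
   Context: An $(m,n)$-framework in the Euclidean plane is a collection of points $\mathbf p=(p_1,\dots,p_m;\,q_1,\dots,q_n)$ such that $p_i\ne q_j$ for all $i,j$. The points $p_i,q_j$ are called joints; the two parts are the collection of the $p$'s and the collection of the $q$'s; pairs $(p_i,q_j)$ are rods, and $|p_iq_j|$ is the distance from $p_i$ to $q_j$. The framework is non-overlapping if all its joints are pairwise distinct. It is flexible if there is a continuous non-constant motion of its joints $\mathbf p(t)$, $t\in[0,1]$, such that $\mathbf p(0)=\mathbf p$, the distances $|p_i(t)-q_j(t)|$ do not depend on $t$, and some two joints from different parts do not move. For $m,n\ge3$, the framework is a Dixon mechanism of the first kind if the $p$'s lie on a line $P$, the $q$'s lie on another line $Q$, and $P\perp Q$. It is a Dixon mechanism of the second kind if one can choose an orthogonal coordinate system and two rectangles with sides parallel to the axes and common center of symmetry at the origin so that the $p$'s are at vertices of one rectangle and the $q$'s are at vertices of the other one. *)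

(* Defs.v *)
From HB Require Import structures.
From mathcomp Require Import all_boot all_order all_fingroup all_algebra.
From mathcomp Require Import all_classical all_reals all_analysis.
From mathcomp Require Import ring.

Set Implicit Arguments.
Unset Strict Implicit.
Unset Printing Implicit Defensive.

Import Order.TTheory GRing.Theory Num.Theory.
Import numFieldNormedType.Exports.

Local Open Scope classical_set_scope.
Local Open Scope ring_scope.

Section Plane.
Variable R : realType.

(* The library norm on 'rV[R]_2 is the sup norm, so the Euclidean structure is
   defined here; the (product) topology of 'rV[R]_2 is the Euclidean one. *)
Definition dot (u v : 'rV[R]_2) : R := \sum_(k < 2) u 0 k * v 0 k.

Definition edist (u v : 'rV[R]_2) : R := Num.sqrt (dot (u - v) (u - v)).

(* A line when [d != 0]. *)
Definition line (a d : 'rV[R]_2) : set 'rV[R]_2 :=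
  [set z | exists s : R, z = a + s *: d].

(* Vertices of the rectangle centered at [o], with sides of lengths [2 x] and
   [2 y] parallel to the axes [e1] and [e2]. *)
Definition rectangle_vertices (o e1 e2 : 'rV[R]_2) (x y : R) : set 'rV[R]_2 :=
  [set z | exists s t : bool,
     z = o + ((-1) ^+ s * x) *: e1 + ((-1) ^+ t * y) *: e2].

End Plane.

Section Frameworks.
Variables (R : realType) (m n : nat).
Implicit Types (p : 'I_m -> 'rV[R]_2) (q : 'I_n -> 'rV[R]_2).

Definition is_framework p q : Prop := forall i j, p i <> q j.

Definition joint p q (v : 'I_m + 'I_n) : 'rV[R]_2 :=
  match v with inl i => p i | inr j => q j end.

Definition non_overlapping p q : Prop := injective (joint p q).

Definition flexible p q : Prop :=
  exists (P : R -> 'I_m -> 'rV[R]_2) (Q : R -> 'I_n -> 'rV[R]_2),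
  [/\ (forall v, {within `[0, 1], continuous (fun t => joint (P t) (Q t) v)}),
      (exists t v, 0 <= t <= 1 /\ joint (P t) (Q t) v <> joint (P 0) (Q 0) v),
      (forall v, joint (P 0) (Q 0) v = joint p q v),
      (forall t i j, 0 <= t <= 1 ->
         edist (P t i) (Q t j) = edist (P 0 i) (Q 0 j)) &
      (exists i j, forall t, 0 <= t <= 1 -> P t i = P 0 i /\ Q t j = Q 0 j)].

Definition dixon1 p q : Prop :=
  exists a d b e : 'rV[R]_2,
  [/\ d != 0, e != 0, dot d e = 0,
      (forall i, line a d (p i)) & (forall j, line b e (q j))].

Definition dixon2 p q : Prop :=
  exists (o e1 e2 : 'rV[R]_2) (x1 y1 x2 y2 : R),
  [/\ dot e1 e1 = 1 /\ dot e2 e2 = 1, dot e1 e2 = 0,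
      [/\ 0 < x1, 0 < y1, 0 < x2 & 0 < y2],
      (forall i, rectangle_vertices o e1 e2 x1 y1 (p i)) &
      (forall j, rectangle_vertices o e1 e2 x2 y2 (q j))].

(* Arguments i k j l stand for the cycle p_i q_j p_k q_l. *)
Definition equal_square_sums p q (i k : 'I_m) (j l : 'I_n) : Prop :=
  edist (p i) (q j) ^+ 2 + edist (p k) (q l) ^+ 2
  = edist (q j) (p k) ^+ 2 + edist (q l) (p i) ^+ 2.

Definition parallelogrammatic p q (i k : 'I_m) (j l : 'I_n) : Prop :=
  edist (p i) (q j) = edist (p k) (q l) /\ edist (q j) (p k) = edist (q l) (p i).

End Frameworks.

Section Conditions.
Variables (R : realType) (m n : nat).

(* ((i, k), (j, l)) stands for the cycle p_i q_j p_k q_l.  Each unoriented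
   cycle without base point is listed several times. *)
Definition cycles : seq (('I_m * 'I_m) * ('I_n * 'I_n)) :=
  enum [pred c : ('I_m * 'I_m) * ('I_n * 'I_n)
       | (c.1.1 != c.1.2) && (c.2.1 != c.2.2)].

Definition cycles_at (i : 'I_m) (j : 'I_n) :=
  [seq c <- cycles | (c.1.1 == i) && (c.2.1 == j)].

(* D i j is an indeterminate value of the squared length of the rod p_i q_j. *)
Definition cycle_eval (c : ('I_m * 'I_m) * ('I_n * 'I_n)) (D : 'M[R]_(m, n)) :
    R^o :=
  let: ((i, k), (j, l)) := c in D i j + D k l - (D k j + D i l).

Fact cycle_eval_linear c : linear (cycle_eval c).
Proof.
case: c => -[i k] [j l] a u v /=; rewrite !mxE /GRing.scale /=; ring.
Qed.

HB.instance Definition _ c :=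
  GRing.isLinear.Build R 'M[R]_(m, n) R^o *:%R (cycle_eval c)
    (cycle_eval_linear c).

Definition cycle_form c : 'Hom('M[R]_(m, n), R^o) := linfun (cycle_eval c).

(* A linear condition is identified with its space of solutions. *)
Definition cycle_condition c : {vspace 'M[R]_(m, n)} := lker (cycle_form c).

Lemma cycle_conditionP (p : 'I_m -> 'rV[R]_2) (q : 'I_n -> 'rV[R]_2) i k j l :
  equal_square_sums p q i k j l <->
  \matrix_(i', j') edist (p i') (q j') ^+ 2 \in cycle_condition ((i, k), (j, l)).
Proof.
have edistC (u v : 'rV[R]_2) : edist u v = edist v u.
  by rewrite /edist /dot; congr Num.sqrt; apply: eq_bigr => x _;
     rewrite !mxE -mulrNN !opprB.
rewrite memv_ker lfunE /= !mxE subr_eq0 /equal_square_sums.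
by rewrite (edistC (q j)) (edistC (q l)); split => /eqP.
Qed.

End Conditions.

Definition symmetric_lengths (R : realType) (p q : 'I_3 -> 'rV[R]_2)
    (a b c d : R) : Prop :=
  let p0 := p 0 in let p1 := p 1 in let p2 := p (inord 2) in
  let q0 := q 0 in let q1 := q 1 in let q2 := q (inord 2) in
  [/\ [/\ edist q0 p0 = a, edist q1 p1 = a & edist q2 p2 = a],
      edist q0 p1 = b /\ edist q1 p0 = b,
      edist q0 p2 = c /\ edist q2 p0 = c &
      edist q1 p2 = d /\ edist q2 p1 = d].

(* Main.v *)
Require Import Defs.
From HB Require Import structures.
From mathcomp Require Import all_boot all_order all_fingroup all_algebra.
From mathcomp Require Import all_classical all_reals all_analysis.
From mathcomp Require Import ring lra.

Set Implicit Arguments.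
Unset Strict Implicit.
Unset Printing Implicit Defensive.

Import Order.TTheory GRing.Theory Num.Theory.
Import numFieldNormedType.Exports.

Local Open Scope ring_scope.

(** Expanding the squares turns the condition of the cycle p_i q_j p_k q_l into
    (p_i - p_k) . (q_j - q_l) = 0. So the conditions hold for all cycles, or
    only for those through a given rod, exactly when every difference of p's
    is orthogonal to every difference of q's, that is, when the two parts
    lie on two orthogonal lines ([dixon1P]). As linear forms on matrices of
    squared lengths, the conditions through the rod p_i q_j are independent
    because the entry of index (k, l) occurs in only one of them, and the
    form of any other cycle is an alternating sum of at most four of them
    ([cycles_at_basis]). Two cycles give the same condition exactly when
    they have the same vertices, since the vertices can be read off the unit
    matrices that violate the condition ([number_of_cycle_conditions]).

    For the mechanisms of the second kind, a vertex of a rectangle is an element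
    of the group of sign pairs, and the squared length of a rod is K +- u +- v,
    the two signs being determined by the product of its ends. Each part misses
    one vertex of its rectangle; numbering the parts so that the joint of index
    1 is opposite to the missing vertex, in both of them, gives the symmetric
    matrix of lengths and the relation between them
    ([dixon2_symmetric_lengths]).

    Conversely, suppose that the rod lengths are symmetric and satisfy the
    relation. The cycle p_0 q_0 p_2 q_2 has opposite sides of equal lengths, so
    it is either a parallelogram or an antiparallelogram. In the first case the
    relation makes p_0, p_1, p_2 equidistant from its center, and q_0, q_1, q_2
    as well; moreover p_0, p_1 and q_0, q_1 are symmetric about a common axis
    through the center, so both parts consist of vertices of rectangles with
    parallel sides ([dixon2_of_parallelogram]).

    In the second case the framework is rigid ([antiparallelogram_rigid]). Take
    the frame with origin at the centroid of p_0, p_2, q_0, q_2 and with unit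
    vector (p_0 - p_2) / 2. The rod lengths determine the ratio of the first
    coordinates of p_1 and p_0, which is also that of q_1 and q_0, and what
    remains is a small polynomial system ([antiparallelogram_coordinates]).
    Unless two joints coincide, the system forces |p_0 p_2| = |q_0 q_2|, hence
    determines the length of the unit vector and all coordinates up to two signs
    ([shape_of_rods]). During a motion the signs cannot change, by the
    intermediate value theorem, so all coordinates in the moving frame are
    constant. As two distinct joints stay fixed, the frame does too, and nothing
    moves. *)

(* The bare name is also that of the extended distance of a metric space. *)
Local Notation edist := Defs.edist.

(** * Plane geometry *)

Section Plane.
Variable R : realType.
Implicit Types (u v x : 'rV[R]_2).

Lemma rV2P u v : u 0 0 = v 0 0 -> u 0 1 = v 0 1 -> u = v.
Proof.
move=> e0 e1; apply/rowP => -[[|[|//]] lt].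
  by rewrite (_ : Ordinal lt = 0)//; apply: val_inj.
by rewrite (_ : Ordinal lt = 1)//; apply: val_inj.
Qed.

Lemma dotE u v : dot u v = u 0 0 * v 0 0 + u 0 1 * v 0 1.
Proof.
rewrite /dot big_ord_recl big_ord1.
by rewrite (_ : lift ord0 ord0 = 1 :> 'I_2)//; apply: val_inj.
Qed.

Lemma dot_ge0 u : 0 <= dot u u.
Proof. by rewrite dotE addr_ge0 // -expr2 sqr_ge0. Qed.

Lemma dot_eq0 u : (dot u u == 0) = (u == 0).
Proof.
rewrite dotE paddr_eq0 -?expr2 ?sqr_ge0// !sqrf_eq0.
apply/andP/eqP => [[/eqP e0 /eqP e1]|->]; last by rewrite !mxE eqxx.
by apply: rV2P; rewrite mxE.
Qed.

Definition sqdist u v : R := dot (u - v) (u - v).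

Lemma edist_sqr u v : edist u v ^+ 2 = sqdist u v.
Proof. by rewrite sqr_sqrtr // dot_ge0. Qed.

Lemma edistC u v : edist u v = edist v u.
Proof. by rewrite /edist !dotE !mxE; congr Num.sqrt; ring. Qed.

Definition rot90 u : 'rV[R]_2 := \row_k (if k == 0 then - u 0 1 else u 0 0).

Lemma frame_decomposition x u : x != 0 ->
  u = (dot x u / dot x x) *: x + (dot (rot90 x) u / dot x x) *: rot90 x.
Proof.
rewrite -dot_eq0 => x0.
by apply: rV2P; move: x0; rewrite !dotE !mxE /= => x0; field.
Qed.

Lemma parallel_of_orthogonal x u v :
  x != 0 -> v != 0 -> dot x u = 0 -> dot x v = 0 -> exists s, u = s *: v.
Proof.
move=> x0 v0 xu xv; have := frame_decomposition v x0; move: v0.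
rewrite (frame_decomposition u x0) xu xv !mul0r !scale0r !add0r.
set b := _ / _; set c := _ / _ => v0 vE; exists (c / b).
have b0 : b != 0 by apply: contra_neq v0 => b0; rewrite vE b0 scale0r.
by rewrite vE scalerA divfK.
Qed.

End Plane.

Lemma non_overlapping_injective (R : realType) m n
    (p : 'I_m -> 'rV[R]_2) (q : 'I_n -> 'rV[R]_2) :
  non_overlapping p q -> [/\ injective p, injective q & is_framework p q].
Proof.
move=> inj; split.
- by move=> i k /(inj (inl i) (inl k)) [].
- by move=> j l /(inj (inr j) (inr l)) [].
- by move=> i j /(inj (inl i) (inr j)).
Qed.

(** * Mechanisms of the first kind *)

Section DixonFirst.
Variables (R : realType) (m n : nat).
Implicit Types (p : 'I_m -> 'rV[R]_2) (q : 'I_n -> 'rV[R]_2).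

(** All the squared norms cancel; only the cross terms remain. *)
Lemma equal_square_sums_dot p q i k j l :
  equal_square_sums p q i k j l <-> dot (p i - p k) (q j - q l) = 0.
Proof.
rewrite /equal_square_sums !edist_sqr /sqdist !dotE !mxE.
split=> [/eqP | ] e; last first.
  apply/eqP; rewrite -subr_eq0; apply/eqP.
  by rewrite -[RHS](mulr0 (-2)) -e; ring.
apply: (@mulfI R (-2)); first by rewrite oppr_eq0 pnatr_eq0.
by rewrite mulr0; move: e; rewrite -subr_eq0 => /eqP <-; ring.
Qed.

Lemma exists_neq k (i : 'I_k) : (1 < k)%N -> exists j : 'I_k, i != j.
Proof.
move=> k1; have /card_gt0P[j ji] : (0 < #|predC1 i|)%N.
  by rewrite cardC1 card_ord -subn1 subn_gt0.
by exists j; rewrite eq_sym.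
Qed.

(** The cycles through one rod suffice: since p_i0 - p_k is orthogonal to
    q_j0 - q_l for all k and l, any nonzero difference of one part is normal to
    the line of the other part. *)
Lemma dixon1P p q (i0 : 'I_m) (j0 : 'I_n) :
    (1 < m)%N -> (1 < n)%N -> non_overlapping p q ->
  dixon1 p q <->
  (forall k l, i0 != k -> j0 != l -> equal_square_sums p q i0 k j0 l).
Proof.
move=> m1 n1 /non_overlapping_injective[pI qI _].
split=> [[a [d [b [e [_ _ de pL qL]]]]] k l _ _|sums].
  apply/equal_square_sums_dot; move: de.
  have [s ->] := pL i0; have [s' ->] := pL k.
  have [t ->] := qL j0; have [t' ->] := qL l.
  rewrite !dotE !mxE => de.
  by rewrite -[RHS](mulr0 ((s - s') * (t - t'))) -de; ring.
have orth k l : dot (p i0 - p k) (q j0 - q l) = 0.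
  have [<-|ik] := eqVneq i0 k; first by rewrite dotE !mxE; ring.
  have [<-|jl] := eqVneq j0 l; first by rewrite dotE !mxE; ring.
  exact/equal_square_sums_dot/sums.
have [k ik] := exists_neq i0 m1; have [l jl] := exists_neq j0 n1.
have d0 : p i0 - p k != 0 by rewrite subr_eq0; apply: contra_neq ik => /pI.
have e0 : q j0 - q l != 0 by rewrite subr_eq0; apply: contra_neq jl => /qI.
have dotC u v : dot u v = dot v u :> R by rewrite !dotE ![u 0 _ * _]mulrC.
exists (p i0), (p i0 - p k), (q j0), (q j0 - q l); split=> //.
- move=> i; have [||s sE] := parallel_of_orthogonal e0 d0 (u := p i0 - p i).
  + by rewrite dotC orth.
  + by rewrite dotC orth.
  by exists (- s); rewrite scaleNr -sE opprB addrC subrK.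
- move=> j.
  have [||s sE] := parallel_of_orthogonal d0 e0 (u := q j0 - q j) => //.
  by exists (- s); rewrite scaleNr -sE opprB addrC subrK.
Qed.

End DixonFirst.

(** * Linear relations between the cycle conditions *)

Lemma eq_set2 (T : finType) (a b x y : T) : a != b ->
  [set a; b] = [set x; y] -> (a = x /\ b = y) \/ (a = y /\ b = x).
Proof.
move=> ab /setP e.
have := e a; have := e b; rewrite !inE !eqxx /= orbT.
by move=> /esym/orP[]/eqP bE /esym/orP[]/eqP aE; subst;
  rewrite ?eqxx in ab *; by [left|right|].
Qed.

Lemma size_undup_map_eq (T : eqType) (U V : eqType) (f : T -> U) (g : T -> V)
    (s : seq T) : {in s &, forall x y, (f x == f y) = (g x == g y)} ->
  size (undup (map f s)) = size (undup (map g s)).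
Proof.
elim: s => //= x s IHs fg.
have fgs : {in s &, forall x y, (f x == f y) = (g x == g y)}.
  by move=> y z ys zs; apply: fg; rewrite inE ?ys ?zs orbT.
have -> : (f x \in map f s) = (g x \in map g s).
  apply/mapP/mapP => -[y ys /eqP e]; exists y => //; apply/eqP.
    by rewrite -fg ?inE ?ys ?eqxx ?orbT.
  by rewrite fg ?inE ?ys ?eqxx ?orbT.
by case: ifP => _; rewrite /= IHs.
Qed.

Section CycleConditions.
Variables (R : realType) (m n : nat).
Local Notation cycle := (('I_m * 'I_m) * ('I_n * 'I_n))%type.
Implicit Types (c : cycle) (D : 'M[R]_(m, n)).

Definition cycle_parts (c : cycle) : {set 'I_m} * {set 'I_n} :=
  ([set c.1.1; c.1.2], [set c.2.1; c.2.2]).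

Lemma mem_cycles c : (c \in cycles m n) = (c.1.1 != c.1.2) && (c.2.1 != c.2.2).
Proof. by rewrite mem_enum. Qed.

Lemma cycle_formE i k j l D :
  cycle_form R ((i, k), (j, l)) D = D i j + D k l - (D k j + D i l).
Proof. by rewrite lfunE. Qed.

(** The vertices of a cycle can be read off the unit matrices that violate its
    condition: they are the entries at its sides. *)
Lemma cycle_form_delta c a b : c \in cycles m n ->
  (cycle_form R c (delta_mx a b) == 0) =
  ~~ ((a \in (cycle_parts c).1) && (b \in (cycle_parts c).2)).
Proof.
case: c => -[i k] [j l]; rewrite mem_cycles /= => /andP[ik jl].
rewrite cycle_formE !mxE !inE ![_ == a]eq_sym ![_ == b]eq_sym.
have [->|ai] := eqVneq a i; have [->|bj] := eqVneq b j;
  rewrite ?(negPf ik) ?(negPf jl) /=;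
  have [?|ak] := eqVneq a k; have [?|bl] := eqVneq b l; subst;
  rewrite ?eqxx ?(negPf ik) ?(negPf jl) /=.
all: by rewrite ?(addr0, add0r, subr0, subrr, sub0r, oppr_eq0, oner_eq0, eqxx).
Qed.

Lemma cycle_condition_eq c c' : c \in cycles m n -> c' \in cycles m n ->
  (cycle_condition R c == cycle_condition R c') =
  (cycle_parts c == cycle_parts c').
Proof.
move=> cP c'P; apply/eqP/eqP => [e|].
  have del a b : (a \in (cycle_parts c).1) && (b \in (cycle_parts c).2) =
                 (a \in (cycle_parts c').1) && (b \in (cycle_parts c').2).
    apply: negb_inj; rewrite -!cycle_form_delta// -!memv_ker.
    by rewrite -/(cycle_condition R c) e.
  have iA : c.1.1 \in (cycle_parts c).1 by rewrite set21.
  have jB : c.2.1 \in (cycle_parts c).2 by rewrite set21.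
  have := del c.1.1 c.2.1; rewrite iA jB => /esym/andP[iA' jB'].
  rewrite [LHS]surjective_pairing [RHS]surjective_pairing; congr pair.
    by apply/setP => x; have := del x c.2.1; rewrite jB jB' !andbT.
  by apply/setP => x; have := del c.1.1 x; rewrite iA iA'.
case: c c' cP c'P => -[i k] [j l] [[i' k'] [j' l']].
rewrite !mem_cycles /= => /andP[ik jl] _ [/(eq_set2 ik) eI /(eq_set2 jl) eJ].
(* Reversing one pair of vertices changes the sign of the form. *)
apply/vspaceP => D; rewrite !memv_ker !cycle_formE.
case: eI => -[-> ->]; case: eJ => -[-> ->] //;
  [rewrite -oppr_eq0 | rewrite -oppr_eq0 |]; congr (_ == 0); ring.
Qed.

Lemma number_of_cycle_conditions :
  size (undup [seq cycle_condition R c | c <- cycles m n]) =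
  ('C(m, 2) * 'C(n, 2))%N.
Proof.
rewrite (size_undup_map_eq (g := cycle_parts)); last exact: cycle_condition_eq.
pose pairs := finset.setX [set A : {set 'I_m} | #|A| == 2%N]%SET
  [set B : {set 'I_n} | #|B| == 2%N]%SET.
have -> : size (undup (map cycle_parts (cycles m n))) = #|pairs|.
  rewrite cardE; apply/perm_size/uniq_perm; rewrite ?undup_uniq ?enum_uniq//.
  move=> -[A B]; rewrite mem_undup mem_enum finset.in_setX !inE.
  apply/mapP/andP => [[c]|[/cards2P[i [k [ik ->]]] /cards2P[j [l [jl ->]]]]].
    by rewrite mem_cycles => /andP[ik jl] [-> ->]; rewrite !cards2 ik jl.
  by exists ((i, k), (j, l)); rewrite ?mem_cycles ?ik ?jl.
by rewrite cardsX !card_draws !card_ord.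
Qed.

Lemma cycles_at_perm (i : 'I_m) (j : 'I_n) :
  perm_eq (cycles_at i j)
    [seq ((i, k), (j, l)) | k <- enum (predC1 i), l <- enum (predC1 j)].
Proof.
apply: uniq_perm.
- by rewrite filter_uniq// enum_uniq.
- apply: allpairs_uniq; rewrite ?enum_uniq//.
  by move=> [k l] [k' l'] _ _ /= [-> ->].
move=> -[[i' k] [j' l]]; rewrite mem_filter mem_cycles /=.
apply/idP/allpairsP => [|[[k' l'] []]].
  move=> /andP[/andP[/eqP-> /eqP->] /andP[ik jl]].
  by exists (k, l); rewrite !mem_enum !inE /= eq_sym ik eq_sym jl.
rewrite !mem_enum !inE /= => ik jl [-> -> -> ->].
by rewrite !eqxx eq_sym ik eq_sym jl.
Qed.

Lemma size_cycles_at (i : 'I_m) (j : 'I_n) :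
  size (cycles_at i j) = ((m - 1) * (n - 1))%N.
Proof.
by rewrite (perm_size (cycles_at_perm i j)) size_allpairs -!cardE !cardC1
  !card_ord !subn1.
Qed.

Lemma mem_cycles_at (i k : 'I_m) (j l : 'I_n) :
  (((i, k), (j, l)) \in cycles_at i j) = (i != k) && (j != l).
Proof. by rewrite mem_filter mem_cycles /= !eqxx. Qed.

(** The form of the cycle p_i q_j p_k q_l is the only one in the family that
    does not vanish on the unit matrix of index (k, l). *)
Lemma cycles_at_free (i : 'I_m) (j : 'I_n) :
  free [seq cycle_form R c | c <- cycles_at i j].
Proof.
set s := cycles_at i j.
apply/(freeP (X := [tuple of map (@cycle_form R m n) (in_tuple s)])).
move=> a /= sum0 x; have xs : (x < size s)%N by [].
have [k [l cE]] : exists k l, nth ((i, i), (j, j)) s x = ((i, k), (j, l)).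
  have := mem_nth ((i, i), (j, j)) xs; case: (nth _ _ _) => -[i' k] [j' l].
  by rewrite mem_filter /= => /andP[/andP[/eqP-> /eqP->] _]; exists k, l.
have := mem_nth ((i, i), (j, j)) xs; rewrite cE mem_cycles_at => /andP[ik jl].
have := congr1 (fun f : 'Hom(_, _) => f (delta_mx k l)) sum0.
rewrite sum_lfunE (bigD1 x)//= big1 => [|y yx].
  rewrite addr0 scale_lfunE (nth_map ((i, i), (j, j)))// cE cycle_formE !mxE.
  rewrite !eqxx (negPf ik) (negPf jl) /= !add0r subr0.
  by rewrite zero_lfunE => <-; rewrite [RHS]mulr1.
rewrite scale_lfunE (nth_map ((i, i), (j, j)))//.
have [k' [l' c'E]] : exists k l, nth ((i, i), (j, j)) s y = ((i, k), (j, l)).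
  have := mem_nth ((i, i), (j, j)) (ltn_ord y).
  case: (nth _ _ _) => -[i' k'] [j' l'].
  by rewrite mem_filter /= => /andP[/andP[/eqP-> /eqP->] _]; exists k', l'.
have c'c : ~~ ((k' == k) && (l' == l)).
  apply: contra yx => /andP[/eqP kk /eqP ll].
  rewrite -val_eqE /= -(nth_uniq ((i, i), (j, j)) _ _ (_ : uniq s))//.
    by rewrite cE c'E kk ll.
  by rewrite filter_uniq// enum_uniq.
rewrite c'E cycle_formE !mxE (negPf ik) (negPf jl) (negPf c'c) !andbF.
by rewrite /= !addr0 subr0 scaler0.
Qed.

(** The form of any cycle is the alternating sum of the forms of the four
    cycles that join the rod p_i q_j to its four sides. *)
Lemma cycles_at_span (i : 'I_m) (j : 'I_n) :
  (<<[seq cycle_form R c | c <- cycles m n]>> =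
   <<[seq cycle_form R c | c <- cycles_at i j]>>)%VS.
Proof.
set V := <<[seq _ | c <- cycles_at i j]>>%VS.
apply/eqP; rewrite eqEsubv; apply/andP; split; last first.
  apply: sub_span => f /mapP[c + ->]; rewrite mem_filter => /andP[_ ?].
  exact: map_f.
(* When k = i or l = j the cycle degenerates and its form is zero. *)
have baseV k l : cycle_form R ((i, k), (j, l)) \in V.
  have [|/norP] := boolP ((i == k) || (j == l)).
    move=> kl; rewrite (_ : cycle_form R _ = 0) ?mem0v//; apply/lfunP => D.
    rewrite cycle_formE zero_lfunE.
    case/orP: kl => /eqP->; first by rewrite subrr.
    by rewrite [X in X - _]addrC subrr.
  by move=> [ik jl]; apply/memv_span/map_f; rewrite mem_cycles_at ik jl.
apply/span_subvP => f /mapP[[[a b] [c d]] _ ->].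
have -> : cycle_form R ((a, b), (c, d)) =
    cycle_form R ((i, a), (j, c)) + cycle_form R ((i, b), (j, d))
    - (cycle_form R ((i, b), (j, c)) + cycle_form R ((i, a), (j, d))).
  apply/lfunP => D; rewrite !(add_lfunE, opp_lfunE) !cycle_formE.
  rewrite -[LHS]/(_ : R) -[RHS]/(_ : R); ring.
by rewrite rpredB ?rpredD.
Qed.

Lemma cycles_at_basis (i : 'I_m) (j : 'I_n) :
  basis_of <<[seq cycle_form R c | c <- cycles m n]>>%VS
           [seq cycle_form R c | c <- cycles_at i j].
Proof. by rewrite /basis_of (cycles_at_span i j) eqxx cycles_at_free. Qed.

Lemma dim_cycle_forms (i : 'I_m) (j : 'I_n) :
  \dim <<[seq cycle_form R c | c <- cycles m n]>>%VS = ((m - 1) * (n - 1))%N.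
Proof.
rewrite (cycles_at_span i j) (eqP (cycles_at_free i j)).
by rewrite size_map size_cycles_at.
Qed.

End CycleConditions.

(** * Frames and the equations of the antiparallelogram *)

Section Frames.
Variable R : realType.
Implicit Types (o x u v : 'rV[R]_2) (a b c d : R).

Definition in_frame o x a b : 'rV[R]_2 := o + a *: x + b *: rot90 x.

Lemma in_frameP o x u : x != 0 -> exists a b, u = in_frame o x a b.
Proof.
move=> /(frame_decomposition (u - o)) uE.
exists (dot x (u - o) / dot x x), (dot (rot90 x) (u - o) / dot x x).
by rewrite /in_frame -addrA -uE addrC subrK.
Qed.

Lemma sqdist_in_frame o x a b c d :
  sqdist (in_frame o x a b) (in_frame o x c d) =
  ((a - c) ^+ 2 + (b - d) ^+ 2) * dot x x.
Proof. by rewrite /sqdist !dotE !mxE /=; ring. Qed.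

(** Two distinct points determine the similarity that maps given coordinates to
    them, because the difference of their coordinates is an invertible complex
    number. *)
Lemma in_frame_rigid o o' x x' a b c d :
  in_frame o x a b != in_frame o x c d ->
  in_frame o x a b = in_frame o' x' a b ->
  in_frame o x c d = in_frame o' x' c d ->
  o = o' /\ x = x'.
Proof.
move=> neq e1 e2; have xx' : x = x'.
  apply/eqP; rewrite -subr_eq0 -dot_eq0; apply/eqP.
  have ac_bd : (a - c) ^+ 2 + (b - d) ^+ 2 != 0.
    apply: contraNneq neq => /eqP.
    rewrite paddr_eq0 ?sqr_ge0// !sqrf_eq0 !subr_eq0.
    by move=> /andP[/eqP-> /eqP->].
  apply: (mulfI ac_bd); rewrite mulr0 -(sqdist_in_frame 0).
  suff -> : in_frame 0 (x - x') a b = in_frame 0 (x - x') c d.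
    by rewrite /sqdist subrr dotE !mxE; ring.
  (* With origin 0, the point of given coordinates depends linearly on the
     axis of the frame. *)
  apply/eqP; rewrite -subr_eq0; apply/eqP.
  transitivity ((in_frame o x a b - in_frame o' x' a b)
                - (in_frame o x c d - in_frame o' x' c d)).
    by apply: rV2P; rewrite !mxE /=; ring.
  by rewrite e1 e2 !subrr.
by split=> //; move: e1; rewrite xx' /in_frame -!addrA => /addIr.
Qed.

End Frames.

Section Scalars.
Variable R : realType.

(** Here (a, w) is half the vector between the midpoints of the diagonals p0 p2
    and q0 q2 of a cycle whose opposite sides are equal, and (v, v') is half of
    the diagonal q0 q2.  When w is nonzero, the diagonals are parallel and both
    are orthogonal to the line of the midpoints. *)
Lemma antiparallelogram_scalars (s a w v v' A C : R) : s != 0 ->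
  ((1 + a - (v - a)) ^+ 2 + (w - (v' - w)) ^+ 2) * s = A ->
  ((a - 1 - (- v - a)) ^+ 2 + (w - (- v' - w)) ^+ 2) * s = A ->
  ((1 + a - (- v - a)) ^+ 2 + (w - (- v' - w)) ^+ 2) * s = C ->
  ((a - 1 - (v - a)) ^+ 2 + (w - (v' - w)) ^+ 2) * s = C ->
  a = 0 /\ w * v' = 0.
Proof.
move=> s0 e1 e2 e3 e4.
have a0 : a * (1 - v) = w * v' by apply: (mulIf s0); lra.
have a1 : a * (1 + v) = - (w * v') by apply: (mulIf s0); lra.
have aE : a = 0 by lra.
by split=> //; rewrite -a0 aE mul0r.
Qed.

(** With l = 1 - k^2 and z = 2 w, the equations read y1^2 - z^2 = l,
    y2^2 - z^2 = l v^2 and (y1 - z) (y2 + z) = l v.  The product of the first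
    two right-hand sides is the square of the third one, so
    (y1 + z) (y2 - z) = l v as well; comparing the two products gives y1 = y2. *)
Lemma rigid_scalars (w v k y1 y2 : R) :
  w != 0 -> v != 0 -> k ^+ 2 != 1 ->
  y1 ^+ 2 - 4 * w ^+ 2 = 1 - k ^+ 2 ->
  y2 ^+ 2 - 4 * w ^+ 2 = v ^+ 2 - (v * k) ^+ 2 ->
  (y1 - 2 * w) * (y2 + 2 * w) = v - k * (v * k) ->
  y1 = y2 /\ v ^+ 2 = 1.
Proof.
move=> w0 v0 k1 e1 e2 e3.
have l0 : 1 - k ^+ 2 != 0 by rewrite subr_eq0 eq_sym.
have e3' : (y1 - 2 * w) * (y2 + 2 * w) = (1 - k ^+ 2) * v by rewrite e3; ring.
have e0 : (1 - k ^+ 2) * v != 0 by rewrite mulf_neq0.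
have e4 : (y1 + 2 * w) * (y2 - 2 * w) = (1 - k ^+ 2) * v.
  apply: (mulfI e0); rewrite -{1}e3'.
  transitivity ((y1 ^+ 2 - 4 * w ^+ 2) * (y2 ^+ 2 - 4 * w ^+ 2)); first ring.
  by rewrite e1 e2; ring.
have y12 : y1 = y2 by apply: (mulfI w0); lra.
by split=> //; apply: (mulfI l0); move: e2; rewrite -y12 e1; lra.
Qed.

(** The case k^2 = 1 excluded in [rigid_scalars]: in the coordinates of
    [antiparallelogram_coordinates], each of these solutions puts p1 or q1 on
    another joint of its part. *)
Lemma overlap_scalars (w v k y1 y2 : R) : k ^+ 2 = 1 ->
  (y1 - 2 * w) * (y2 + 2 * w) = v - k * (v * k) ->
  (k = 1 \/ k = -1) /\ (y1 = 2 * w \/ y2 = - (2 * w)).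
Proof.
move=> k1 yE; split.
  by move/eqP: k1; rewrite sqrf_eq1 => /orP[]/eqP; auto.
have /eqP : (y1 - 2 * w) * (y2 + 2 * w) = 0.
  by rewrite yE; transitivity (v * (1 - k ^+ 2)); [ring|rewrite k1; ring].
by rewrite mulf_eq0 subr_eq0 addr_eq0 => /orP[]/eqP; auto.
Qed.

End Scalars.

(** * Six joints with symmetric rod lengths *)

Section SixPoints.
Variable R : realType.
Implicit Types (p q o x u v : 'rV[R]_2) (A B C D : R).

Definition symmetric_rods p0 p1 p2 q0 q1 q2 A B C D : Prop :=
  [/\ [/\ sqdist p0 q0 = A, sqdist p1 q1 = A & sqdist p2 q2 = A],
      sqdist p0 q1 = B /\ sqdist p1 q0 = B,
      sqdist p0 q2 = C /\ sqdist p2 q0 = C &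
      sqdist p1 q2 = D /\ sqdist p2 q1 = D].

Lemma symmetric_lengths_rods (p q : 'I_3 -> 'rV[R]_2) a b c d :
  symmetric_lengths p q a b c d ->
  symmetric_rods (p 0) (p 1) (p (inord 2)) (q 0) (q 1) (q (inord 2))
    (a ^+ 2) (b ^+ 2) (c ^+ 2) (d ^+ 2).
Proof.
move=> [[e1 e2 e3] [e4 e5] [e6 e7] [e8 e9]].
by split; split; rewrite -edist_sqr 1?edistC; congr (_ ^+ 2); rewrite // edistC.
Qed.

(** The frame is centered at the common midpoint of p0 p2 and q0 q2, with unit
    vector p0 - p1.  The relation between the lengths makes p0 and p1, and also
    q0 and q1, equidistant from the center, so that p0 and p1 have opposite
    first coordinates; |p0 q0| = |p1 q1| and |p0 q1| = |p1 q0| then give the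
    same for q0 and q1. *)
Lemma parallelogram_coordinates p0 p1 p2 q0 q1 q2 A B C D :
    symmetric_rods p0 p1 p2 q0 q1 q2 A B C D -> A + C = B + D ->
    p0 + p2 = q0 + q2 -> p0 != p1 -> p1 != p2 -> q0 != q1 -> q1 != q2 ->
  exists o x a b c d,
    [/\ [/\ a != 0, b != 0, c != 0, d != 0 & x != 0],
       [/\ p0 = in_frame o x a b, p1 = in_frame o x (- a) b
         & p2 = in_frame o x (- a) (- b)]
     & [/\ q0 = in_frame o x c d, q1 = in_frame o x (- c) d
         & q2 = in_frame o x (- c) (- d)]].
Proof.
move=> rods sumABCD par p01 p12 q01 q12.
set o := 2^-1 *: (p0 + p2); set x := p0 - p1.
have x0 : x != 0 by rewrite subr_eq0.
have [a [b p0E]] := in_frameP o p0 x0.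
have [c [d q0E]] := in_frameP o q0 x0.
have [c' [d' q1E]] := in_frameP o q1 x0.
have p1E : p1 = in_frame o x (a - 1) b.
  have -> : p1 = p0 - x by rewrite opprB addrC subrK.
  by rewrite {1}p0E; apply: rV2P; rewrite !mxE; ring.
have p2E : p2 = in_frame o x (- a) (- b).
  have -> : p2 = 2 *: o - p0.
    by rewrite scalerA mulfV ?pnatr_eq0// scale1r addrC addKr.
  by rewrite p0E; apply: rV2P; rewrite !mxE; ring.
have q2E : q2 = in_frame o x (- c) (- d).
  have -> : q2 = 2 *: o - q0.
    by rewrite scalerA mulfV ?pnatr_eq0// scale1r par addrC addKr.
  by rewrite q0E; apply: rV2P; rewrite !mxE; ring.
have s0 : dot x x != 0 by rewrite dot_eq0.
move: p01 p12 q01 q12; move: rods.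
rewrite /symmetric_rods p0E p1E p2E q0E q1E q2E !sqdist_in_frame.
move: (dot x x) s0 => s s0 [[eA1 eA2 eA3] [eB1 eB2] [eC1 eC2] [eD1 eD2]].
(* From here on every step is linear in the nine length equations. *)
have aE : a = 1 / 2.
  suff : 2 * a - 1 = 0 by lra.
  by apply: (mulIf s0); lra.
have norms : (c ^+ 2 + d ^+ 2) * s = (c' ^+ 2 + d' ^+ 2) * s by lra.
have c'E : c' = - c.
  suff : c' + c = 0 by lra.
  by apply: (mulIf s0); move: eA1 eA2 eB1 eB2; rewrite aE => *; lra.
subst a c' => p01 p12 q01 q12.
have b0 : b != 0.
  apply: contraNneq p12 => ->; apply/eqP; congr (in_frame _ _ _ _); lra.
have d'E : d' = d.
  by apply: (mulfI b0); apply: (mulIf s0); lra.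
subst d'; exists o, x, (1 / 2), b, c, d; split; first split=> //.
- by apply: contraNneq q01 => ->; rewrite oppr0.
- by apply: contraNneq q12 => ->; rewrite oppr0.
- by split=> //; congr (in_frame _ _ _ _); lra.
by [].
Qed.

(** The first coordinates of p1 and q1 are proportional to those of p0 and q0
    because |p1 q2|^2 - |p1 q0|^2 and |q1 p2|^2 - |q1 p0|^2 are both D - B.  The
    relation A + C = B + D gives the equations in y1^2 and y2^2, and |p1 q1| the
    last one.  The second coordinates are written relative to the midpoint of the
    diagonal of the other part, that is as y1 - w and y2 + w, to make these
    equations symmetric. *)
Lemma antiparallelogram_coordinates p0 p1 p2 q0 q1 q2 A B C D :
    symmetric_rods p0 p1 p2 q0 q1 q2 A B C D -> A + C = B + D ->
    p0 + p2 != q0 + q2 -> p0 != p2 ->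
  let o := 4^-1 *: (p0 + p2 + q0 + q2) in
  let x := 2^-1 *: (p0 - p2) in
  let s := dot x x in
  exists w (v : R) k y1 y2,
  [/\ [/\ p0 = in_frame o x 1 w, p2 = in_frame o x (- 1) w
        & p1 = in_frame o x k (y1 - w)],
      [/\ q0 = in_frame o x v (- w), q2 = in_frame o x (- v) (- w)
        & q1 = in_frame o x (v * k) (y2 + w)],
      [/\ s != 0, w != 0, 4 * s * v = C - A, (C - A) * k = D - B
        & 2 * s * (1 + v ^+ 2 + 4 * w ^+ 2) = A + C],
      y1 ^+ 2 - 4 * w ^+ 2 = 1 - k ^+ 2 /\
      y2 ^+ 2 - 4 * w ^+ 2 = v ^+ 2 - (v * k) ^+ 2 &
      (y1 - 2 * w) * (y2 + 2 * w) = v - k * (v * k)].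
Proof.
move=> rods sumABCD par p02 o x s.
have x0 : x != 0 by rewrite scaler_eq0 invr_eq0 pnatr_eq0 subr_eq0.
have [a [w mE]] := in_frameP o (2^-1 *: (p0 + p2)) x0.
have [v [v' yE]] := in_frameP 0 (2^-1 *: (q0 - q2)) x0.
have [k [y1 p1E]] := in_frameP o p1 x0.
have [k' [y2 q1E]] := in_frameP o q1 x0.
have p0E : p0 = in_frame o x (1 + a) w.
  transitivity (2^-1 *: (p0 + p2) + x).
    by apply: rV2P; rewrite !mxE; field.
  by rewrite mE; apply: rV2P; rewrite !mxE; ring.
have p2E : p2 = in_frame o x (a - 1) w.
  transitivity (2^-1 *: (p0 + p2) - x).
    by apply: rV2P; rewrite !mxE; field.
  by rewrite mE; apply: rV2P; rewrite !mxE; ring.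
have q0E : q0 = in_frame o x (v - a) (v' - w).
  transitivity (2 *: o - 2^-1 *: (p0 + p2) + 2^-1 *: (q0 - q2)).
    by apply: rV2P; rewrite !mxE; field.
  by rewrite mE yE; apply: rV2P; rewrite !mxE; ring.
have q2E : q2 = in_frame o x (- v - a) (- v' - w).
  transitivity (2 *: o - 2^-1 *: (p0 + p2) - 2^-1 *: (q0 - q2)).
    by apply: rV2P; rewrite !mxE; field.
  by rewrite mE yE; apply: rV2P; rewrite !mxE; ring.
have s0 : s != 0 by rewrite dot_eq0.
have aw : (a != 0) || (w != 0).
  rewrite -negb_and; apply: contraNN par => /andP[/eqP a0 /eqP w0].
  apply/eqP; rewrite {1}p0E {1}p2E {1}q0E {1}q2E a0 w0.
  by apply: rV2P; rewrite !mxE; ring.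
move: rods; rewrite /symmetric_rods {1 2 3}p0E {1 2 3}p1E {1 2 3}p2E.
rewrite {1 2 3}q0E {1 2 3}q1E {1 2 3}q2E !sqdist_in_frame -/s.
move=> [[eA1 eA2 eA3] [eB1 eB2] [eC1 eC2] [eD1 eD2]].
have [a0 wv'] := antiparallelogram_scalars s0 eA1 eA3 eC1 eC2.
have w0 : w != 0 by move: aw; rewrite a0 eqxx.
have v'0 : v' = 0 by apply: (mulfI w0); rewrite mulr0.
move: p0E p1E p2E q0E q1E q2E eA1 eA2 eA3 eB1 eB2 eC1 eC2 eD1 eD2.
rewrite a0 v'0 => {aw mE yE wv'} p0E p1E p2E q0E q1E q2E.
(* [o] and [x] are made opaque, since their bodies mention the six points. *)
move: (x) (o) @s s0 p0E p1E p2E q0E q1E q2E => X O /=; set s := dot X X => s0.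
move=> p0E p1E p2E q0E q1E q2E eA1 eA2 eA3 eB1 eB2 eC1 eC2 eD1 eD2.
have v_eq : 4 * s * v = C - A by lra.
have k_eq : 4 * s * v * k = D - B by lra.
have k'E : k' = v * k by apply: (mulfI s0); lra.
subst k'; exists w, v, k, (y1 + w), (y2 - w); split.
- by split; [rewrite p0E addr0|rewrite p2E sub0r|rewrite p1E addrK].
- by split; rewrite ?q0E ?q2E ?q1E ?subr0 ?sub0r ?oppr0 ?sub0r ?subrK.
- by split=> //; [by rewrite -v_eq | lra].
- by split; apply: (mulfI s0); lra.
by apply: (mulfI s0); lra.
Qed.

End SixPoints.

Lemma ord3P (i : 'I_3) : [\/ i = 0, i = 1 | i = inord 2].
Proof.
case: i => [[|[|[|//]]]] lt; [constructor 1|constructor 2|constructor 3];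
  by apply: val_inj; rewrite /= ?inordK.
Qed.

Lemma inord2_neq :
  ((inord 2 : 'I_3) == 0) = false /\ ((inord 2 : 'I_3) == 1) = false.
Proof. by rewrite -!val_eqE /= !inordK. Qed.

(** * Rigidity of the antiparallelogram case *)

Section Motion.
Variable R : realType.
Implicit Types (p q : 'I_3 -> 'rV[R]_2) (A B C D : R).

(** The frame of [antiparallelogram_coordinates]. *)
Definition frame_center p q := 4^-1 *: (p 0 + p (inord 2) + q 0 + q (inord 2)).
Definition frame_axis p := 2^-1 *: (p 0 - p (inord 2)).
(** [height] and [rise] are the numbers w and y1 = y2 of
    [antiparallelogram_coordinates], multiplied by the squared length of the
    axis so that they are polynomials in the coordinates of the joints. *)
Definition height p q : R :=
  dot (rot90 (frame_axis p)) (p 0 - frame_center p q).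
Definition rise p q : R :=
  dot (rot90 (frame_axis p)) (p 1 - 2^-1 *: (q 0 + q (inord 2))).

Definition shape_coordinates (w v k y : R) (j : 'I_3 + 'I_3) : R * R :=
  match j with
  | inl i => if i == 0 then (1, w) else if i == 1 then (k, y - w) else (- 1, w)
  | inr i => if i == 0 then (v, - w) else if i == 1 then (v * k, y + w)
             else (- v, - w)
  end.

Lemma dot_rot90_in_frame o x a b c d :
  dot (rot90 x) (in_frame o x a b - in_frame o x c d) = (b - d) * dot x x :> R.
Proof. by rewrite !dotE !mxE /=; ring. Qed.

Definition rods_of p q :=
  symmetric_rods (p 0) (p 1) (p (inord 2)) (q 0) (q 1) (q (inord 2)).

(** The last assertion expresses all joints through the rod lengths, the frame
    and the signs of [height] and [rise]: as the two diagonals have the same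
    length, s is the squared length of the axis. *)
Lemma shape_of_rods p q A B C D (s := `|C - A| / 4) (k := (D - B) / (C - A))
    (coordinates := shape_coordinates (height p q / s) ((C - A) / (4 * s)) k
                                      (rise p q / s)) :
    rods_of p q A B C D -> A + C = B + D ->
    C != A -> (D - B) ^+ 2 != (C - A) ^+ 2 -> height p q != 0 ->
  [/\ height p q ^+ 2 = (s * (A + C) - 4 * s ^+ 2) / 8,
      rise p q ^+ 2 = s ^+ 2 * (1 - k ^+ 2) + 4 * height p q ^+ 2 &
      forall j, joint p q j = in_frame (frame_center p q) (frame_axis p)
                                       (coordinates j).1 (coordinates j).2].
Proof.
move=> rods sumABCD CA DBCA height0.
have CA0 : C - A != 0 by rewrite subr_eq0.
have p02 : p 0 != p (inord 2).
  apply: contraNneq CA => p02; case: rods => -[_ _ <-] _ [<- _] _.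
  by rewrite p02.
have par : p 0 + p (inord 2) != q 0 + q (inord 2).
  apply: contraNneq height0 => par; rewrite /height (_ : _ - _ = frame_axis p).
    by rewrite dotE !mxE /=; apply/eqP; ring.
  rewrite /frame_center /frame_axis -addrA -par.
  by apply: rV2P; rewrite !mxE; field.
have [w [v [k' [y1 [y2 [[p0E p2E p1E] [q0E q2E q1E]]]]]]] :=
  antiparallelogram_coordinates rods sumABCD par p02.
rewrite -/(frame_axis p) -/(frame_center p q) in p0E p2E p1E q0E q2E q1E *.
set o := frame_center p q in p0E p2E p1E q0E q2E q1E *.
set x := frame_axis p in p0E p2E p1E q0E q2E q1E *.
move=> [s0 w0 vE kE sumE] [y1E y2E] y12E.
have k'E : k' = k by rewrite /k -kE mulrAC mulfV ?mul1r.
have v0 : v != 0 by apply: contra_eq_neq vE => ->; rewrite mulr0 eq_sym.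
have k1 : k' ^+ 2 != 1.
  by apply: contraNneq DBCA => k1; rewrite -kE exprMn k1 mulr1 eqxx.
have [y1y2 v1] := rigid_scalars w0 v0 k1 y1E y2E y12E.
have sE : dot x x = s.
  have v_norm : `|v| = 1.
    by move/eqP: v1; rewrite sqrf_eq1 => /orP[]/eqP ->; rewrite ?normrN normr1.
  by rewrite /s -vE !normrM v_norm (ger0_norm (dot_ge0 x)) normr_nat; field.
have oE : o = in_frame o x 0 0 by rewrite /in_frame !scale0r !addr0.
have heightE : height p q = w * s.
  by rewrite /height -/x -/o p0E {2}oE dot_rot90_in_frame sE subr0.
have riseE : rise p q = y1 * s.
  rewrite /rise -/x p1E q0E q2E.
  have -> : 2^-1 *: (in_frame o x v (- w) + in_frame o x (- v) (- w)) =
            in_frame o x 0 (- w) by apply: rV2P; rewrite !mxE /=; field.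
  by rewrite dot_rot90_in_frame sE; ring.
rewrite sE in s0 vE sumE.
split.
- by rewrite heightE -sumE v1; field.
- by rewrite riseE heightE -k'E -y1E; ring.
have wE : height p q / s = w by rewrite heightE mulfK.
have yE : rise p q / s = y1 by rewrite riseE mulfK.
have v'E : (C - A) / (4 * s) = v.
  by rewrite -vE mulrAC mulfV ?mul1r// mulf_neq0.
rewrite /coordinates wE yE v'E -k'E => -[i|i] /=; case: (ord3P i) => ->;
  by rewrite ?inord2_neq.1 ?inord2_neq.2 //= q1E y1y2.
Qed.

Lemma height_neq0 p q A B C D : rods_of p q A B C D -> A + C = B + D ->
    p 0 != p (inord 2) -> p 0 + p (inord 2) != q 0 + q (inord 2) ->
  height p q != 0.
Proof.
move=> rods sumABCD p02 par.
have [w [v [k [y1 [y2 [[p0E _ _] _ [s0 w0 _ _ _] _ _]]]]]] :=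
  antiparallelogram_coordinates rods sumABCD par p02.
rewrite /height {1}p0E -/(frame_axis p) -/(frame_center p q).
rewrite -[X in _ - X](_ : in_frame (frame_center p q) (frame_axis p) 0 0 = _);
  last by rewrite /in_frame !scale0r !addr0.
by rewrite dot_rot90_in_frame subr0 mulf_neq0.
Qed.

(** The non-degeneracy conditions needed for rigidity only concern the rod
    lengths, so they hold during a whole motion once they hold at its start. *)
Lemma rods_of_nonoverlapping p q A B C D :
  rods_of p q A B C D -> A + C = B + D -> non_overlapping p q ->
  p 0 + p (inord 2) != q 0 + q (inord 2) ->
  C != A /\ (D - B) ^+ 2 != (C - A) ^+ 2.
Proof.
move=> rods sumABCD /non_overlapping_injective[p_inj q_inj _] par.
have pI i k : i != k -> p i != p k by apply: contra_neq => /p_inj.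
have qI j l : j != l -> q j != q l by apply: contra_neq => /q_inj.
have n02 : (0 : 'I_3) != inord 2 by rewrite eq_sym inord2_neq.1.
have n12 : (1 : 'I_3) != inord 2 by rewrite eq_sym inord2_neq.2.
have [w [v [k [y1 [y2 [[p0E p2E p1E] [q0E q2E q1E]]]]]]] :=
  antiparallelogram_coordinates rods sumABCD par (pI _ _ n02).
set o := (_ *: _) in p0E p2E p1E q0E q2E q1E *.
set x := (_ *: _) in p0E p2E p1E q0E q2E q1E *.
move=> [s0 w0 vE kE sumE] _ y12E.
have v0 : v != 0.
  by apply: contraNneq (qI _ _ n02) => v0; rewrite q0E q2E v0 oppr0.
have CA0 : C - A != 0 by rewrite -vE !mulf_neq0// pnatr_eq0.
split; first by rewrite -subr_eq0.
apply/negP => /eqP DB; have k1 : k ^+ 2 = 1.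
  by apply: (mulfI (expf_neq0 2 CA0)); rewrite mulr1 -exprMn kE.
have := overlap_scalars k1 y12E => -[[kE'|kE'] [yE|yE]].
- have /eqP[] := pI 0 1 isT; rewrite p0E p1E kE' yE.
  by congr (in_frame _ _ _ _); ring.
- have /eqP[] := qI 0 1 isT; rewrite q0E q1E kE' yE mulr1.
  by congr (in_frame _ _ _ _); ring.
- have /eqP[] := pI _ _ n12; rewrite p2E p1E kE' yE.
  by congr (in_frame _ _ _ _); ring.
- have /eqP[] := qI _ _ n12; rewrite q2E q1E kE' yE mulrN1.
  by congr (in_frame _ _ _ _); ring.
Qed.

End Motion.

Section Continuity.
Local Open Scope classical_set_scope.
Variable R : realType.

(** A continuous function with values in {0, c, -c} is constant: otherwise it
    would also take the value c / 2. *)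
Lemma constant_of_square_constant (f : R -> R) :
  {within `[0, 1], continuous f} ->
  (forall t, 0 <= t <= 1 -> f t = 0 \/ f t ^+ 2 = f 0 ^+ 2) ->
  forall t, 0 <= t <= 1 -> f t = f 0.
Proof.
move=> fcont fsq t t01; apply/eqP; apply/negP => /negP ft.
have ft' : f t = 0 \/ f t = - f 0.
  case: (fsq t t01) => [|/eqP]; first by left.
  by rewrite eqf_sqr (negPf ft) => /eqP; right.
have [t0 t1] := andP t01.
have f0 : f 0 != 0.
  by apply: contraNneq ft => f0; case: ft'; rewrite f0 ?oppr0 => ->.
have [||c cint fc] := @IVT R f 0 t (f 0 / 2) t0.
- apply: continuous_subspaceW fcont => z /=; rewrite !in_itv /= => /andP[-> zt].
  exact: le_trans zt t1.
- by have [f0' | f0'] := ltP 0 (f 0); rewrite minElt maxElt; case: ltP;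
    case: ft' => ->; lra.
have [|fc0|/eqP] := fsq c.
- by move: cint; rewrite in_itv /= => /andP[-> ct]; apply: le_trans ct t1.
- by move: f0; rewrite (_ : f 0 = 0) ?eqxx//; lra.
rewrite fc exprMn -subr_eq0 -{2}[_ ^+ 2]mulr1 -mulrBr mulf_eq0 sqrf_eq0.
by rewrite (negPf f0) /= subr_eq0 => /eqP; lra.
Qed.

End Continuity.

Section Rigidity.
Local Open Scope classical_set_scope.
Variable R : realType.
Implicit Types (p q : 'I_3 -> 'rV[R]_2).

Lemma continuous_dot_rot90 (T : topologicalType) (f g : T -> 'rV[R]_2) :
  continuous f -> continuous g -> continuous (fun t => dot (rot90 (f t)) (g t)).
Proof.
move=> fc gc.
have -> : (fun t => dot (rot90 (f t)) (g t)) =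
    (fun t => f t 0 0 * g t 0 1 - f t 0 1 * g t 0 0).
  by apply/funext => t; rewrite dotE !mxE /=; ring.
have coord (h : T -> 'rV[R]_2) k :
    continuous h -> continuous (fun t => h t 0 k).
  move=> hc t; apply: (@continuous_comp _ _ _ h (fun M : 'rV[R]_2 => M 0 k)).
    exact: hc.
  exact: coord_continuous.
by move=> t; apply: cvgB; apply: cvgM; apply: coord.
Qed.

Lemma continuous_axis (T : topologicalType) (P : T -> 'I_3 -> 'rV[R]_2) :
  (forall i, continuous (P^~ i)) -> continuous (fun t => frame_axis (P t)).
Proof.
by move=> Pc t; apply: cvgZ; [exact: cvg_cst|apply: cvgB; apply: Pc].
Qed.

Lemma continuous_height (T : topologicalType) (P Q : T -> 'I_3 -> 'rV[R]_2) :
  (forall i, continuous (P^~ i)) -> (forall j, continuous (Q^~ j)) ->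
  continuous (fun t => height (P t) (Q t)).
Proof.
move=> Pc Qc; apply: continuous_dot_rot90; first exact: continuous_axis.
move=> t; apply: cvgB; first exact: Pc.
apply: cvgZ; first exact: cvg_cst.
by apply: cvgD (Qc _ t); apply: cvgD (Qc _ t); apply: cvgD (Pc _ t); apply: Pc.
Qed.

Lemma continuous_rise (T : topologicalType) (P Q : T -> 'I_3 -> 'rV[R]_2) :
  (forall i, continuous (P^~ i)) -> (forall j, continuous (Q^~ j)) ->
  continuous (fun t => rise (P t) (Q t)).
Proof.
move=> Pc Qc; apply: continuous_dot_rot90; first exact: continuous_axis.
move=> t; apply: cvgB; first exact: Pc.
by apply: cvgZ; [exact: cvg_cst|apply: cvgD (Qc _ t); apply: Qc].
Qed.

Lemma rods_of_motion p q p' q' A B C D :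
  (forall i j, edist (p' i) (q' j) = edist (p i) (q j)) ->
  rods_of p q A B C D -> rods_of p' q' A B C D.
Proof.
move=> e; have sq i j : sqdist (p' i) (q' j) = sqdist (p i) (q j).
  by rewrite -!edist_sqr e.
by rewrite /rods_of /symmetric_rods !sq.
Qed.

(** At each time, [height] is zero or has its initial absolute value; being
    continuous, it is constant, hence never zero.  So the cycle p_0 q_0 p_2 q_2 remains
    an antiparallelogram; then the square of [rise] is constant, and so is
    [rise]. *)
Lemma antiparallelogram_rigid p q A B C D :
    non_overlapping p q -> rods_of p q A B C D -> A + C = B + D ->
    p 0 + p (inord 2) != q 0 + q (inord 2) ->
  ~ flexible p q.
Proof.
move=> inj rods sumABCD par.
have [CA DBCA] := rods_of_nonoverlapping rods sumABCD inj par.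
have [p_inj _ framework] := non_overlapping_injective inj.
move=> [P [Q [cont [t1 [v1 [t1_01 moved]]] start lengths [i0 [j0 fixed]]]]].
have P0 i : P 0 i = p i := start (inl i).
have Q0 j : Q 0 j = q j := start (inr j).
have rods_t t : 0 <= t <= 1 -> rods_of (P t) (Q t) A B C D.
  by move=> t01; apply: rods_of_motion rods => i j; rewrite lengths// P0 Q0.
pose H t := height (P t) (Q t); pose K t := rise (P t) (Q t).
have shape_t t : 0 <= t <= 1 -> H t != 0 -> _ :=
  fun t01 Ht => shape_of_rods (rods_t t t01) sumABCD CA DBCA Ht.
have ends : 0 <= (0 : R) <= 1 by rewrite lexx ler01.
have [Hcont Kcont] :
    {within `[0, 1], continuous H} /\ {within `[0, 1], continuous K}.
  have Pc i : {within `[0, 1], continuous (fun t => P t i)} := cont (inl i).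
  have Qc j : {within `[0, 1], continuous (fun t => Q t j)} := cont (inr j).
  by split; [apply: continuous_height | apply: continuous_rise].
have H0 : H 0 != 0.
  apply: height_neq0 (rods_t 0 ends) sumABCD _ _; rewrite ?P0 ?Q0//.
  by apply/eqP => /p_inj /eqP; rewrite eq_sym inord2_neq.1.
have [H0sq K0sq j0E] := shape_t 0 ends H0.
have Ht t : 0 <= t <= 1 -> H t = H 0.
  apply: constant_of_square_constant Hcont _ t => t t01.
  have [->|Ht] := eqVneq (H t) 0; first by left.
  by right; have [-> _ _] := shape_t t t01 Ht.
have Ht0 t : 0 <= t <= 1 -> H t != 0 by move=> t01; rewrite Ht.
have Kt t : 0 <= t <= 1 -> K t = K 0.
  apply: constant_of_square_constant Kcont _ t => t t01; right.
  have [_ -> _] := shape_t t t01 (Ht0 t t01).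
  by rewrite [RHS]K0sq -/(H t) -/(H 0) Ht.
have [_ _ jtE] := shape_t t1 t1_01 (Ht0 t1 t1_01).
have [Pf Qf] := fixed t1 t1_01.
rewrite -/(H t1) -/(K t1) Ht// Kt// in jtE; rewrite -/(H 0) -/(K 0) in j0E.
have neq : joint (P 0) (Q 0) (inl i0) != joint (P 0) (Q 0) (inr j0).
  by apply/eqP; rewrite /= P0 Q0; apply: framework.
rewrite !j0E in neq.
have [] := @in_frame_rigid _ _ (frame_center (P t1) (Q t1)) _
  (frame_axis (P t1)) _ _ _ _ neq.
- by rewrite -jtE -j0E /= Pf.
- by rewrite -jtE -j0E /= Qf.
by move=> oE xE; apply: moved; rewrite jtE j0E oE xE.
Qed.

End Rigidity.

(** * Mechanisms of the second kind *)

Section DixonSecond.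
Variable R : realType.
Implicit Types (p q : 'I_3 -> 'rV[R]_2) (o x e u v : 'rV[R]_2).

Lemma in_frame_rectangle o x a b (r := Num.sqrt (dot x x)) : x != 0 ->
  rectangle_vertices o (r^-1 *: x) (r^-1 *: rot90 x) (`|a| * r) (`|b| * r)
    (in_frame o x a b).
Proof.
move=> x0; have r0 : r != 0 by rewrite sqrtr_eq0 -ltNge lt0r dot_eq0 x0 dot_ge0.
exists (a < 0), (b < 0).
by rewrite !scalerA !mulrA -!realEsign ?num_real// !mulfK.
Qed.

Lemma dixon2_of_parallelogram p q A B C D :
    rods_of p q A B C D -> A + C = B + D -> non_overlapping p q ->
    p 0 + p (inord 2) = q 0 + q (inord 2) ->
  dixon2 p q.
Proof.
move=> rods sumABCD /non_overlapping_injective[p_inj q_inj _] par.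
have pI i k : i != k -> p i != p k by apply: contra_neq => /p_inj.
have qI j l : j != l -> q j != q l by apply: contra_neq => /q_inj.
have n12 : (1 : 'I_3) != inord 2 by rewrite eq_sym inord2_neq.2.
have [z [x [a [b [c [d [[a0 b0 c0 d0 x0] [p0E p1E p2E] [q0E q1E q2E]]]]]]]] :=
  parallelogram_coordinates rods sumABCD par
    (pI 0 1 isT) (pI _ _ n12) (qI 0 1 isT) (qI _ _ n12).
set r := Num.sqrt (dot x x).
have r0 : 0 < r by rewrite sqrtr_gt0 lt0r dot_eq0 x0 dot_ge0.
have r_sqr : dot x x = r ^+ 2 by rewrite sqr_sqrtr ?dot_ge0.
have rot90_sq : dot (rot90 x) (rot90 x) = r ^+ 2.
  by rewrite -r_sqr !dotE !mxE /=; ring.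
have scale (u v : 'rV[R]_2) : dot (r^-1 *: u) (r^-1 *: v) = dot u v / r ^+ 2.
  by rewrite !dotE !mxE; field; rewrite gt_eqF.
have rsq0 : r ^+ 2 != 0 by rewrite expf_neq0 ?gt_eqF.
exists z, (r^-1 *: x), (r^-1 *: rot90 x).
exists (`|a| * r), (`|b| * r), (`|c| * r), (`|d| * r).
split.
- by rewrite !scale r_sqr rot90_sq mulfV.
- by rewrite scale (_ : dot x _ = 0) ?mul0r// dotE !mxE /=; ring.
- by rewrite !mulr_gt0 ?normr_gt0.
- move=> i; have [->|->|->] := ord3P i; rewrite ?p0E ?p1E ?p2E.
  + exact: in_frame_rectangle.
  + by rewrite -(normrN a); exact: in_frame_rectangle.
  + by rewrite -(normrN a) -(normrN b); exact: in_frame_rectangle.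
- move=> i; have [->|->|->] := ord3P i; rewrite ?q0E ?q1E ?q2E.
  + exact: in_frame_rectangle.
  + by rewrite -(normrN c); exact: in_frame_rectangle.
  + by rewrite -(normrN c) -(normrN d); exact: in_frame_rectangle.
Qed.

(** The joint of index 1 has to be the corner opposite to the missing one. *)
Lemma perm_of_three_corners (f : 'I_3 -> bool * bool) : injective f ->
  exists (s : {perm 'I_3}) (b c : bool),
    [/\ f (s 0) = (b, ~~ c), f (s 1) = (b, c) & f (s (inord 2)) = (~~ b, c)].
Proof.
move=> f_inj; have card_f : #|codom f| = 3%N by rewrite card_codom// card_ord.
have [g gP] : exists g, g \notin codom f.
  apply/existsP; rewrite -negb_forall; apply/forallP => fT.
  have : #|codom f| = #|{: bool * bool}| by apply: eq_card => h; rewrite fT.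
  by rewrite card_f card_prod !card_bool.
have hit h : h != g -> exists i, f i = h.
  move=> hg; suff : h \in codom f by move=> /codomP[i ->]; exists i.
  have card_g : #|codom f| = #|predC1 g|.
    by rewrite cardC1 card_prod !card_bool card_f.
  have sub_g : codom f \subset predC1 g.
    by apply/fintype.subsetP => k kf; rewrite inE; apply: contraNneq gP => <-.
  by rewrite (subset_cardP card_g sub_g) inE.
case: g gP hit => b c gP hit.
have [i0 f0] : exists i, f i = (~~ b, c).
  by apply: hit; rewrite xpair_eqE; case: (b).
have [i1 f1] : exists i, f i = (~~ b, ~~ c).
  by apply: hit; rewrite xpair_eqE; case: (b).
have [i2 f2] : exists i, f i = (b, ~~ c).
  by apply: hit; rewrite xpair_eqE; case: (c); rewrite andbF.
pose h (i : 'I_3) := if i == 0 then i0 else if i == 1 then i1 else i2.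
have [h0 h1 h2] : [/\ h 0 = i0, h 1 = i1 & h (inord 2) = i2].
  by rewrite /h inord2_neq.1 inord2_neq.2.
have h_inj : injective h.
  apply: (@inj_compr _ _ _ f) => i k /=.
  have [->|->|->] := ord3P i; have [->|->|->] := ord3P k;
    rewrite ?h0 ?h1 ?h2 ?f0 ?f1 ?f2 //; by case: (b); case: (c).
exists (perm h_inj), (~~ b), (~~ c).
by rewrite !permE h0 h1 h2 f0 f1 f2 !negbK.
Qed.

Definition vertex o e1 e2 (x y : R) (b : bool * bool) : 'rV[R]_2 :=
  o + ((-1) ^+ b.1 * x) *: e1 + ((-1) ^+ b.2 * y) *: e2.

Lemma sqdist_orthonormal o e1 e2 a b c d :
  dot e1 e1 = 1 -> dot e2 e2 = 1 -> dot e1 e2 = 0 ->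
  sqdist (o + a *: e1 + b *: e2) (o + c *: e1 + d *: e2) =
  (a - c) ^+ 2 + (b - d) ^+ 2.
Proof.
move=> e11 e22 e12.
transitivity ((a - c) ^+ 2 * dot e1 e1 + (b - d) ^+ 2 * dot e2 e2
              + 2 * (a - c) * (b - d) * dot e1 e2).
  by rewrite /sqdist !dotE !mxE; ring.
by rewrite e11 e22 e12; ring.
Qed.

(** With both parts numbered as in [perm_of_three_corners], the product of the
    sign pairs of p_i and q_i is the same for all i, so the rods p_i q_i have
    equal lengths; the products for a and c are opposite in both signs, and so
    are those for b and d, whence a^2 + c^2 = b^2 + d^2. *)
Lemma dixon2_symmetric_lengths p q : non_overlapping p q -> dixon2 p q ->
  exists (s t : {perm 'I_3}) (a b c d : R),
    symmetric_lengths (p \o s) (q \o t) a b c d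
    /\ a ^+ 2 + c ^+ 2 = b ^+ 2 + d ^+ 2.
Proof.
move=> /non_overlapping_injective[p_inj q_inj _].
move=> [z [e1 [e2 [x1 [y1 [x2 [y2 [[e11 e22] e12 _ pV qV]]]]]]]].
have [f fE] : {f : 'I_3 -> bool * bool &
    forall i, p i = vertex z e1 e2 x1 y1 (f i)}.
  apply: (choice (P := fun i b => p i = vertex z e1 e2 x1 y1 b)) => i.
  by have [b [c ->]] := pV i; exists (b, c).
have [g gE] : {g : 'I_3 -> bool * bool &
    forall i, q i = vertex z e1 e2 x2 y2 (g i)}.
  apply: (choice (P := fun i b => q i = vertex z e1 e2 x2 y2 b)) => i.
  by have [b [c ->]] := qV i; exists (b, c).
have f_inj : injective f by move=> i k e; apply: p_inj; rewrite !fE e.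
have g_inj : injective g by move=> i k e; apply: q_inj; rewrite !gE e.
have [s [b [c [s0 s1 s2]]]] := perm_of_three_corners f_inj.
have [t [b' [c' [t0 t1 t2]]]] := perm_of_three_corners g_inj.
pose l i j := edist (q (t i)) (p (s j)).
exists s, t, (l 0 0), (l 0 1), (l 0 (inord 2)), (l 1 (inord 2)).
have lE i j : l i j ^+ 2 = sqdist (q (t i)) (p (s j)) by exact: edist_sqr.
have sqdistE := sqdist_orthonormal z _ _ _ _ e11 e22 e12.
split; last first.
  by rewrite !lE !gE !fE t0 t1 s0 s1 s2 /vertex !sqdistE /= !signrN; ring.
have edistE u v : edist u v = Num.sqrt (sqdist u v) by [].
rewrite /symmetric_lengths /l /= !edistE !gE !fE t0 t1 t2 s0 s1 s2 /vertex.
rewrite !sqdistE /= !signrN.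
by split; do ?split; congr Num.sqrt; ring.
Qed.

Lemma dixon2_perm p q (s t : {perm 'I_3}) :
  dixon2 (p \o s) (q \o t) -> dixon2 p q.
Proof.
move=> [z [e1 [e2 [x1 [y1 [x2 [y2 [e11 e12 pos pV qV]]]]]]]].
exists z, e1, e2, x1, y1, x2, y2; split=> // i.
  by have := pV (s^-1%g i); rewrite /= permKV.
by have := qV (t^-1%g i); rewrite /= permKV.
Qed.

Lemma flexible_perm p q (s t : {perm 'I_3}) :
  flexible p q -> flexible (p \o s) (q \o t).
Proof.
move=> [P [Q [cont [u [v [u01 moved]]] start lengths [i0 [j0 fixed]]]]].
exists (fun t' => P t' \o s), (fun t' => Q t' \o t); split.
- by case=> i; [exact: cont (inl (s i))|exact: cont (inr (t i))].
- exists u; case: v moved => i moved.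
    by exists (inl (s^-1%g i)); rewrite /= permKV.
  by exists (inr (t^-1%g i)); rewrite /= permKV.
- by case=> i; [exact: start (inl (s i))|exact: start (inr (t i))].
- by move=> t' i j t'01; exact: lengths.
- exists (s^-1%g i0), (t^-1%g j0) => t' t'01; rewrite /= !permKV.
  exact: fixed.
Qed.

Lemma non_overlapping_perm p q (s t : {perm 'I_3}) :
  non_overlapping p q -> non_overlapping (p \o s) (q \o t).
Proof.
move=> inj [i|i] [k|k] /=.
- by move/(inj (inl _) (inl _)) => [/perm_inj ->].
- by move/(inj (inl _) (inr _)).
- by move/(inj (inr _) (inl _)).
- by move/(inj (inr _) (inr _)) => [/perm_inj ->].
Qed.

Lemma symmetric_lengths_dixon2 p q a b c d :
    non_overlapping p q -> flexible p q ->
    symmetric_lengths p q a b c d -> a ^+ 2 + c ^+ 2 = b ^+ 2 + d ^+ 2 ->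
  dixon2 p q.
Proof.
move=> inj flex /symmetric_lengths_rods rods sumABCD.
have [par|par] := eqVneq (p 0 + p (inord 2)) (q 0 + q (inord 2)).
  exact: dixon2_of_parallelogram rods sumABCD inj par.
by have := antiparallelogram_rigid inj rods sumABCD par flex.
Qed.

Lemma symmetric_lengths_parallelogrammatic p q a b c d (i j : 'I_3) :
  symmetric_lengths p q a b c d -> parallelogrammatic p q i j i j.
Proof.
move=> [[e1 e2 e3] [e4 e5] [e6 e7] [e8 e9]].
have diag k : edist (p k) (q k) = a.
  by rewrite edistC; have [->|->|->] := ord3P k.
split; rewrite ?diag//.
by have [->|->|->] := ord3P i; have [->|->|->] := ord3P j; congruence.
Qed.

End DixonSecond.

Theorem proposition1 (R : realType) :
  (forall m n : nat, (3 <= m)%N -> (3 <= n)%N ->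
    [/\ (forall (p : 'I_m -> 'rV[R]_2) (q : 'I_n -> 'rV[R]_2),
           is_framework p q -> non_overlapping p q ->
           (dixon1 p q <->
            forall i k j l, i != k -> j != l -> equal_square_sums p q i k j l)),
        size (undup [seq cycle_condition R c | c <- cycles m n])
          = ('C(m, 2) * 'C(n, 2))%N,
        \dim <<[seq cycle_form R c | c <- cycles m n]>>%VS
          = ((m - 1) * (n - 1))%N &
        forall (i : 'I_m) (j : 'I_n),
          basis_of <<[seq cycle_form R c | c <- cycles m n]>>%VS
                   [seq cycle_form R c | c <- cycles_at i j]
          /\ (forall (p : 'I_m -> 'rV[R]_2) (q : 'I_n -> 'rV[R]_2),
                is_framework p q -> non_overlapping p q ->
                (dixon1 p q <->
                 forall k l, i != k -> j != l -> equal_square_sums p q i k j l))])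
  /\
  (forall p q : 'I_3 -> 'rV[R]_2,
     is_framework p q -> non_overlapping p q -> flexible p q ->
     (dixon2 p q <->
      exists (s t : {perm 'I_3}) (a b c d : R),
        symmetric_lengths (p \o s) (q \o t) a b c d
        /\ a ^+ 2 + c ^+ 2 = b ^+ 2 + d ^+ 2)
     /\
     (forall (s t : {perm 'I_3}) (a b c d : R),
        symmetric_lengths (p \o s) (q \o t) a b c d ->
        a ^+ 2 + c ^+ 2 = b ^+ 2 + d ^+ 2 ->
        forall i j : 'I_3, (i < j)%N ->
          parallelogrammatic (p \o s) (q \o t) i j i j)).
Proof.
split=> [m n m3 n3|p q _ inj flex].
  have [m1 n1] : (1 < m)%N /\ (1 < n)%N by split; apply: ltnW.
  have i0 : 'I_m := Ordinal (ltnW m1).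
  have j0 : 'I_n := Ordinal (ltnW n1).
  split.
  - move=> p q _ inj; split; last first.
      by move=> sums; apply/(dixon1P i0 j0 m1 n1 inj) => k l; apply: sums.
    by move=> dix i k j l; move: k l; apply/(dixon1P i j m1 n1 inj).
  - exact: number_of_cycle_conditions.
  - exact: dim_cycle_forms i0 j0.
  - move=> i j; split; first exact: cycles_at_basis.
    by move=> p q _ inj; apply: dixon1P.
split; last first.
  move=> s t a b c d sym _ i j _.
  exact: symmetric_lengths_parallelogrammatic sym.
split=> [|[s [t [a [b [c [d [sym rel]]]]]]]].
  exact: dixon2_symmetric_lengths.
apply: (@dixon2_perm R p q s t); apply: symmetric_lengths_dixon2 sym rel.
- exact: non_overlapping_perm.
- exact: flexible_perm.
Qed.
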